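(* (Non-Commutative Backward Criterion.) Let $G=\{g_1,\dots,g_s\}\subseteq K\langle X\rangle\setminus\{0\}$ be the current set of polynomials in an execution of the Buchberger Procedure, at a moment when the new element $g_s$ has just been appended in step (B4). Let $1\le i\le j\le s-1$ and let ${\rm o}_{i,j}(w_i,w'_i;w_j,w'_j)\in{\rm NTObs}(i,j)$ be a non-trivial obstruction. Suppose that the following three conditions are satisfied. (a) There are two words $w,w'\in\langle X\rangle$ such that $w_j{\rm Lw}_\sigma(g_j)w'_j=w\,{\rm Lw}_\sigma(g_s)w'$. (b) The obstruction ${\rm o}_{i,s}(w_i,w'_i;w,w')$ (with the words $w,w'$ of (a)) is either an obstruction without overlap or a (proper or improper) multiple of a non-trivial obstruction in $\bigcup_{1\le k\le s}{\rm NTObs}(k,s)$. (c) The obstruction ${\rm o}_{j,s}(w_j,w'_j;w,w')$ (with the same $w,w'$) is either an obstruction without overlap or a (proper or improper) multiple of a non-trivial obstruction in $\bigcup_{1\le k\le s}{\rm NTObs}(k,s)$. Then ${\rm o}_{i,j}(w_i,w'_i;w_j,w'_j)$ can be removed from the set $\bigcup_{1\le k\le l\le s-1}{\rm NTObs}(k,l)$ of previously constructed obstructions in the execution of the Buchberger Procedure; that is, if at this moment ${\rm o}_{i,j}(w_i,w'_i;w_j,w'_j)$ is deleted from $B$ (in case it still belongs to $B$), then the procedure still enumerates a $\sigma$-Gröbner basis of $I$, and it still stops after finitely many steps with a finite $\sigma$-Gröbner basis of $I$ whenever $I$ has a finite $\sigma$-Gröbner basis.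
   Context: Basic notation. $K$ is a field, $X=\{x_1,\dots,x_n\}$ a finite alphabet, $\langle X\rangle$ the monoid of words in $X$ (product is concatenation, empty word is $1$), and $K\langle X\rangle$ the free associative $K$-algebra. A word ordering is a (total) well-ordering $\sigma$ on $\langle X\rangle$ such that $w_1\ge_\sigma w_2$ implies $w_3w_1w_4\ge_\sigma w_3w_2w_4$ for all words; $\sigma$ is a fixed word ordering. For $f\ne0$, ${\rm Lw}_\sigma(f)$ is the $\sigma$-largest word in the support of $f$ and ${\rm Lc}_\sigma(f)$ its coefficient. A subset $G$ of a two-sided ideal $I$ is a $\sigma$-Gröbner basis of $I$ if $\{{\rm Lw}_\sigma(g)\mid g\in G\setminus\{0\}\}$ generates the two-sided ideal $\langle {\rm Lw}_\sigma(f)\mid f\in I\setminus\{0\}\rangle$. Obstructions. For $G=\{g_1,\dots,g_s\}\subseteq K\langle X\rangle\setminus\{0\}$ let $F_s=(K\langle X\rangle\otimes_KK\langle X\rangle)^s$ be the free two-sided module with canonical basis $e_1,\dots,e_s$. If words satisfy $w_i{\rm Lw}_\sigma(g_i)w'_i=w_j{\rm Lw}_\sigma(g_j)w'_j$, then ${\rm o}_{i,j}(w_i,w'_i;w_j,w'_j)=\frac1{{\rm Lc}_\sigma(g_i)}w_ie_iw'_i-\frac1{{\rm Lc}_\sigma(g_j)}w_je_jw'_j\in F_s$, whenever non-zero, is called an obstruction of $g_i$ and $g_j$; its S-polynomial is $S_{i,j}(w_i,w'_i;w_j,w'_j)=\frac1{{\rm Lc}_\sigma(g_i)}w_ig_iw'_i-\frac1{{\rm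 Lc}_\sigma(g_j)}w_jg_jw'_j$. A multiple of this obstruction is an obstruction ${\rm o}_{i,j}(ww_i,w'_iw';ww_j,w'_jw')$ with $w,w'\in\langle X\rangle$; the multiple is proper if $ww'\neq1$. The obstruction has an overlap if the indicated occurrences of ${\rm Lw}_\sigma(g_i)$ and ${\rm Lw}_\sigma(g_j)$ in the word $w_i{\rm Lw}_\sigma(g_i)w'_i=w_j{\rm Lw}_\sigma(g_j)w'_j$ overlap in a non-empty word (share a letter position); otherwise it has no overlap. For $i\ne j$, an obstruction of $g_i,g_j$ is non-trivial if it has an overlap and is of one of the forms ${\rm o}_{i,j}(w_i,1;1,w'_j)$, ${\rm o}_{i,j}(1,w'_i;w_j,1)$, ${\rm o}_{i,j}(w_i,w'_i;1,1)$, ${\rm o}_{i,j}(1,1;w_j,w'_j)$; an obstruction of $g_i$ with itself is non-trivial if it has an overlap and is of the form ${\rm o}_{i,i}(1,w'_i;w_i,1)$ with $w_i,w'_i\ne1$. ${\rm NTObs}(i,j)$ is the set of non-trivial obstructions of $g_i$ and $g_j$. Normal remainder. ${\rm NR}_{\sigma,G}(f)$ is any polynomial $p$ produced by the division algorithm: start with $p=0$, $v=f$; while $v\ne0$: if ${\rm Lw}_\sigma(v)=w\,{\rm Lw}_\sigma(g_i)w'$ for some $i$ (take the smallest such $i$) and words $w,w'$, replace $v$ by $v-\frac{{\rm Lc}_\sigma(v)}{{\rm Lc}_\sigma(g_i)}wg_iw'$; otherwise move the leading monomial of $v$ from $v$ to $p$. Buchberger Procedure. Input: $s\ge1$ and a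 set $G=\{g_1,\dots,g_s\}$ of non-zero polynomials generating the two-sided ideal $I$. (B1) Let $B=\bigcup_{1\le i\le j\le s}{\rm NTObs}(i,j)$. (B2) If $B=\emptyset$, return $G$. Otherwise select an obstruction in $B$ using a fair strategy (one which ensures that every obstruction is selected eventually) and delete it from $B$. (B3) Compute its S-polynomial $S$ and $S'={\rm NR}_{\sigma,G}(S)$; if $S'=0$ go to (B2). (B4) Increase $s$ by one, append $g_s=S'$ to $G$, append $\bigcup_{1\le i\le s}{\rm NTObs}(i,s)$ to $B$, and go to (B2). The procedure ''enumerates a $\sigma$-Gröbner basis of $I$'' if the set of all polynomials which are in $G$ at some stage is a $\sigma$-Gröbner basis of $I$. *)

(* Defs.v *)
From HB Require Import structures.
From mathcomp Require Import all_boot all_algebra.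
From mathcomp Require Import finmap.
From mathcomp Require Import boolp classical_sets cardinality wochoice.
From mathcomp.multinomials Require Import monalg.

Set Implicit Arguments.
Unset Strict Implicit.
Unset Printing Implicit Defensive.

Import GRing.Theory.

Local Open Scope classical_set_scope.
Local Open Scope ring_scope.

(* [monalg] keeps these two notations local. *)
Notation "1" := mone : monom_scope.
Notation "u * v" := (mmul u v) : monom_scope.

Notation word n := {fmonom 'I_n}.
Notation freealg K n := {malg K[word n]}.

(* The direct limit of the free two-sided modules (K<X> (x) K<X>)^s along the
   inclusions e_k |-> e_k; its K-basis is formed by the triples (k, w, w'),
   which stand for w e_k w'.  One module then serves every stage of the
   procedure.  Indices start at 0. *)
Notation freebimod K n := {malg K[(nat * word n * word n)%type]}.

Definition word_ordering n (sigma : rel (word n)) : Prop :=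
  [/\ total_order sigma, well_order sigma
    & forall w1 w2 w3 w4 : word n,
        sigma w2 w1 -> sigma (w3 * w2 * w4)%M (w3 * w1 * w4)%M].

Section FreeAlgebra.
Context (K : fieldType) (n : nat).
Notation W := (word n).
Notation A := (freealg K n).

(* [sigma u v] means that u is at most v, so the greatest word comes last.
   Lw 0 is the junk value 1. *)
Definition Lw (sigma : rel W) (f : A) : W :=
  last (1%M : W) (sort sigma (msupp f)).

Definition Lc (sigma : rel W) (f : A) : K := f@_(Lw sigma f).

Definition twosided_ideal (I : set A) : Prop :=
  [/\ I 0, forall f g, I f -> I g -> I (f + g)
    & forall f g h, I g -> I (f * g * h)].

Definition ideal_gen (S : set A) : set A := smallest twosided_ideal S.

Definition Lw_set (sigma : rel W) (S : set A) : set A :=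
  [set << Lw sigma f >> | f in [set f | S f /\ f != 0]].

Definition groebner_basis (sigma : rel W) (I G : set A) : Prop :=
  G `<=` I /\ ideal_gen (Lw_set sigma G) = ideal_gen (Lw_set sigma I).

End FreeAlgebra.

Section Obstructions.
Context (K : fieldType) (n : nat) (sigma : rel (word n)).
Notation W := (word n).
Notation A := (freealg K n).
Notation F := (freebimod K n).
Implicit Types (G : seq A) (w : W).

Definition obs G i (wi wi' : W) j (wj wj' : W) : F :=
  (Lc sigma G`_i)^-1 *: << (i, wi, wi') >> -
  (Lc sigma G`_j)^-1 *: << (j, wj, wj') >>.

Definition is_obstruction G i (wi wi' : W) j (wj wj' : W) : Prop :=
  [/\ (i < size G)%N, (j < size G)%N,
      (wi * Lw sigma G`_i * wi')%M = (wj * Lw sigma G`_j * wj')%M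
    & obs G i wi wi' j wj wj' != 0].

(* The two-sided K<X>-linear map e_k |-> g_k; see [SpolyE]. *)
Definition Spoly G (o : F) : A :=
  \sum_(b <- msupp o) o@_b *: (<< b.1.2 >> * G`_b.1.1 * << b.2 >>).

Lemma SpolyE G i wi wi' j wj wj' :
  Spoly G (obs G i wi wi' j wj wj') =
  (Lc sigma G`_i)^-1 *: (<< wi >> * G`_i * << wi' >>) -
  (Lc sigma G`_j)^-1 *: (<< wj >> * G`_j * << wj' >>).
Proof.
pose h (b : nat * W * W) : A := << b.1.2 >> * G`_b.1.1 * << b.2 >>.
have SpolyM o : Spoly G o = mmap (mkmalgU (1%M : W)) h o.
  by rewrite /Spoly /mmap; apply: eq_bigr => b _; rewrite mul_malgC.
have mmapZ1 (c : K) b : mmap (mkmalgU (1%M : W)) h (c *: << b >>) = c *: h b.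
  have -> : c *: << b >> = << c *g b >> :> F.
    by apply/malgP => x; rewrite mcoeffZ !mcoeffU mulr_natr.
  by rewrite mmapU mul_malgC.
rewrite SpolyM; transitivity ((Lc sigma G`_i)^-1 *: h (i, wi, wi') -
  (Lc sigma G`_j)^-1 *: h (j, wj, wj')); last exact: erefl.
by rewrite -!mmapZ1 -mmapB.
Qed.

(* p is a letter position in both indicated occurrences. *)
Definition overlap G i (wi wi' : W) j (wj wj' : W) : Prop :=
  let ui := Lw sigma G`_i in let uj := Lw sigma G`_j in
  exists p : nat, (size wi <= p < size wi + size ui)%N /\
                  (size wj <= p < size wj + size uj)%N.

Definition nontrivial G i (wi wi' : W) j (wj wj' : W) : Prop :=
  [/\ is_obstruction G i wi wi' j wj wj',
      overlap G i wi wi' j wj wj'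
    & if i == j then
        [/\ wi = 1%M, wj' = 1%M, wj <> 1%M & wi' <> 1%M]
      else
        [\/ wi' = 1%M /\ wj = 1%M, wi = 1%M /\ wj' = 1%M,
            wj = 1%M /\ wj' = 1%M | wi = 1%M /\ wi' = 1%M]].

Definition NTObs G i j : set F :=
  [set o | exists wi wi' wj wj' : W,
     nontrivial G i wi wi' j wj wj' /\ o = obs G i wi wi' j wj wj'].

Definition multiple_of_NTObs G k l : set F :=
  [set o | exists a a' b b' u u' : W,
     nontrivial G k a a' l b b' /\
     o = obs G k (u * a)%M (a' * u')%M l (u * b)%M (b' * u')%M].

(* [division G p v r]: the division algorithm may go from (p, v) to r. *)
Inductive division G : A -> A -> A -> Prop :=
| division_done p : division G p 0 p
| division_reduce p v r i w w' :
    v != 0 -> (i < size G)%N ->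
    Lw sigma v = (w * Lw sigma G`_i * w')%M ->
    (forall k u u', (k < i)%N -> Lw sigma v <> (u * Lw sigma G`_k * u')%M) ->
    division G p
      (v - (Lc sigma v / Lc sigma G`_i) *: (<< w >> * G`_i * << w' >>)) r ->
    division G p v r
| division_move p v r :
    v != 0 ->
    (forall k u u', (k < size G)%N ->
       Lw sigma v <> (u * Lw sigma G`_k * u')%M) ->
    division G (p + << Lc sigma v *g Lw sigma v >>)
               (v - << Lc sigma v *g Lw sigma v >>) r ->
    division G p v r.

Definition NR G (f r : A) : Prop := division G 0 f r.

End Obstructions.

Section BuchbergerProcedure.
Context (K : fieldType) (n : nat) (sigma : rel (word n)).
Notation A := (freealg K n).
Notation F := (freebimod K n).

(* [polys] is the list G, [pending] the set B. *)
Record state := State { polys : seq A; pending : set F }.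

Definition initial (g : seq A) : state :=
  State g [set o | exists i j : nat,
             (i <= j < size g)%N /\ NTObs sigma g i j o].

(* One round (B2)-(B4) in which the obstruction o is selected. *)
Definition buchberger_step (x : state) (o : F) (y : state) : Prop :=
  pending x o /\
  exists2 r : A, NR sigma (polys x) (Spoly (polys x) o) r &
    if r == 0 then y = State (polys x) (pending x `\ o)
    else let G := rcons (polys x) r in let s := size (polys x) in
      y = State G ((pending x `\ o) `|`
                   [set o' | exists2 i : nat, (i <= s)%N & NTObs sigma G i s o']).

(* An execution on the input g in which, in addition, the obstructions in D t
   are deleted from B right after round t (D t = set0 for all t gives the
   procedure itself).  An execution that has stopped (B empty) stays in its
   final state. *)
Definition execution (g : seq A) (D : nat -> set F)
    (st : nat -> state) (sel : nat -> F) : Prop :=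
  st 0%N = initial g /\
  forall t, if `[< pending (st t) = set0 >] then st t.+1 = st t
    else exists2 y : state, buchberger_step (st t) (sel t) y &
           st t.+1 = State (polys y) (pending y `\` D t).

Definition fair (D : nat -> set F)
    (st : nat -> state) (sel : nat -> F) : Prop :=
  forall t o, pending (st t) o ->
    exists2 t', (t <= t')%N &
      (pending (st t') o /\ sel t' = o) \/ D t' o.

Definition delete_at (t : nat) (o : F) : nat -> set F :=
  fun t' => if t' == t then [set o] else set0.

Definition enumerates_groebner (I : set A) (st : nat -> state) : Prop :=
  groebner_basis sigma I [set f | exists t, f \in polys (st t)].

Definition stops_with_groebner (I : set A) (st : nat -> state) : Prop :=
  exists t, pending (st t) = set0 /\
            groebner_basis sigma I [set` polys (st t)].

Definition has_finite_groebner (I : set A) : Prop :=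
  exists2 H : set A, finite_set H & groebner_basis sigma I H.

End BuchbergerProcedure.

(* Main.v *)
(* A pair of occurrences a lw(p) a' = b lw(q) b' = L of leading words is
   harmless when its S-polynomial is a combination of products w h w', with h among the
   enumerated polynomials, whose leading words are all smaller than L.  If this
   holds for every non-trivial obstruction it holds for every pair: strip the
   common prefix and suffix, and note that disjoint occurrences always are
   harmless.  A well-founded induction on the largest leading word in
   a representation of f then shows that lw(f) is a multiple of some lw(h).

   Fairness makes every non-trivial obstruction except the deleted one harmless,
   since its S-polynomial reduces to zero or to a polynomial which is appended.
   The S-polynomial of the deleted obstruction is the difference of those of
   o_{i,s} and o_{j,s}, which live at the same word L; each of these is without
   overlap or a multiple of an obstruction involving g_s, and the latter is not
   the deleted one.

   If the ideal has a finite Groebner basis then the current set is a Groebner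
   basis from some round on; afterwards every remainder vanishes, so the finite
   set of pending obstructions only shrinks. *)

Require Import Defs.
From HB Require Import structures.
From mathcomp Require Import all_boot all_algebra.
From mathcomp Require Import finmap.
From mathcomp Require Import boolp classical_sets cardinality wochoice.
From mathcomp.multinomials Require Import monalg.
From mathcomp Require Import zify.

Set Implicit Arguments.
Unset Strict Implicit.
Unset Printing Implicit Defensive.

Import GRing.Theory.

Local Open Scope classical_set_scope.
Local Open Scope ring_scope.

Section Words.
Context (n : nat).
Implicit Types u v x y : word n.

Lemma word_size_mul u v : size (u * v)%M = (size u + size v)%N.
Proof. by rewrite fmM size_cat. Qed.

Lemma word_size1 : size (1%M : word n) = 0%N.
Proof. by rewrite fm1. Qed.

Lemma word_size_eq0 u : size u = 0%N -> u = 1%M.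
Proof. by move/size0nil => hu; apply: val_inj; rewrite /= hu fm1. Qed.

Lemma word_mulI u v x : (u * v)%M = (u * x)%M -> v = x.
Proof.
move/(congr1 (@fmonom_val _)); rewrite !fmM => /eqP.
by rewrite eqseq_cat // eqxx /= => /eqP; apply: val_inj.
Qed.

Lemma word_mulIr u v x : (v * u)%M = (x * u)%M -> v = x.
Proof.
move=> e; have := congr1 (@fmonom_val _) e; rewrite !fmM => /eqP.
rewrite eqseq_cat; first by case/andP => /eqP + _; apply: val_inj.
have := congr1 (fun m : word n => size m) e.
by rewrite !word_size_mul => /addIn.
Qed.

Lemma word_shiftI a b u v : (a * u * b)%M = (a * v * b)%M -> u = v :> word n.
Proof. by move/word_mulIr/word_mulI. Qed.

Lemma word_levi u v x y : (u * v)%M = (x * y)%M -> (size u <= size x)%N ->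
  exists z, x = (u * z)%M /\ v = (z * y)%M.
Proof.
move=> e lux; pose z : word n := FMonom (drop (size u) x).
have ex : x = (u * z)%M.
  apply: val_inj; rewrite /= fmM /=.
  have := congr1 (fun m : word n => take (size u) m) e; rewrite !fmM.
  by rewrite take_size_cat // takel_cat // => {1}->; rewrite cat_take_drop.
exists z; split => //; apply: (@word_mulI u).
by rewrite e {1}ex mulmA.
Qed.

End Words.

Section WordOrdering.
Context (n : nat) (sigma : rel (word n)) (hsigma : word_ordering sigma).
Implicit Types u v x a b : word n.

Let tot : total_order sigma. Proof. by case: hsigma. Qed.

Lemma wo_refl : reflexive sigma. Proof. by case: tot => [[[]]]. Qed.
Lemma wo_trans : transitive sigma. Proof. by case: tot => [[[]]]. Qed.
Lemma wo_anti : antisymmetric sigma. Proof. by case: tot => [[]]. Qed.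
Lemma wo_total : total sigma. Proof. by case: tot. Qed.

Definition wlt u v := sigma u v && (u != v).

Lemma wlt_irr u : wlt u u = false. Proof. by rewrite /wlt eqxx andbF. Qed.

Lemma wle_lt_trans u v x : sigma u v -> wlt v x -> wlt u x.
Proof.
move=> uv /andP[vx nvx]; apply/andP; split; first exact: wo_trans vx.
by apply: contraNneq nvx => eux; apply/eqP/wo_anti; rewrite vx -eux uv.
Qed.

Lemma wle_eqVlt u v : sigma u v -> u = v \/ wlt u v.
Proof. by move=> uv; rewrite /wlt uv; case: eqVneq => [|_]; [left|right]. Qed.

Lemma wle_shift a b u v : sigma u v -> sigma (a * u * b)%M (a * v * b)%M.
Proof. by case: hsigma => _ _; apply. Qed.

Lemma wlt_shift a b u v : wlt u v -> wlt (a * u * b)%M (a * v * b)%M.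
Proof.
case/andP=> /(wle_shift a b) uv nuv; rewrite /wlt uv.
by apply: contraNneq nuv => /word_shiftI ->.
Qed.

Lemma wo_ind (P : word n -> Prop) :
  (forall u, (forall v, wlt v u -> P v) -> P u) -> forall u, P u.
Proof.
move=> IH u; apply: contrapT => nPu.
have [_ wo _] := hsigma.
have [|m [[mA mmin] _]] := wo [pred x | `[< ~ P x >]].
  by exists u; rewrite inE.
move: mA; rewrite inE; apply; apply: IH => v /andP[vm nvm].
apply: contrapT => nPv; case/negP: nvm; apply/eqP/wo_anti; rewrite vm.
by apply: mmin; rewrite inE.
Qed.

End WordOrdering.

Section FreeAlgebra.
Context (K : fieldType) (n : nat).
Notation W := (word n).
Notation A := (freealg K n).
Implicit Types (f g h p q : A) (a b u v w : W) (c : K) (I S : set A).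

Lemma mulrZ f c g : f * (c *: g) = c *: (f * g).
Proof.
apply/malgP => x; rewrite [RHS]mcoeffZ.
apply: (eq_trans (mcoeffMlw x (fsubset_refl (msupp f)) (msuppZ_le c g))).
rewrite (mcoeffMlw x (fsubset_refl (msupp f)) (fsubset_refl (msupp g))).
rewrite mulr_sumr; apply: eq_bigr => k _.
rewrite mulr_sumr; apply: eq_bigr => l _.
by rewrite mcoeffZ mulrCA mulrnAr.
Qed.

Fact shift_key : unit. Proof. exact: tt. Qed.

(* Locked, as unification would otherwise unfold the products. *)
Definition shift : W -> W -> A -> A :=
  locked_with shift_key (fun w w' f => << w >> * f * << w' >>).

Lemma shift_mul w w' f : shift w w' f = << w >> * f * << w' >>.
Proof. by rewrite /shift unlock. Qed.

Lemma shiftD w w' : {morph shift w w' : f g / f + g}.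
Proof. by move=> f g; rewrite !shift_mul mulrDr mulrDl. Qed.

Lemma shift0 w w' : shift w w' 0 = 0.
Proof. by rewrite !shift_mul mulr0 mul0r. Qed.

Lemma shiftZ w w' c f : shift w w' (c *: f) = c *: shift w w' f.
Proof. by rewrite !shift_mul mulrZ -scalerAl. Qed.

Lemma shiftB w w' : {morph shift w w' : f g / f - g}.
Proof. by move=> f g; rewrite -!scaleN1r shiftD shiftZ. Qed.

Lemma shiftU w w' c u : shift w w' << c *g u >> = << c *g (w * u * w')%M >>.
Proof. by rewrite shift_mul !malgM_def !fgmulUU mul1r mulr1. Qed.

Lemma malg_sumZ f : f = \sum_(u <- msupp f) f@_u *: << u >>.
Proof.
rewrite {1}[f]monalgE; apply: eq_bigr => k _.
by apply/malgP => x; rewrite [RHS]mcoeffZ !mcoeffU mulr_natr.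
Qed.

Lemma shiftE w w' f :
  shift w w' f = \sum_(u <- msupp f) << f@_u *g (w * u * w')%M >>.
Proof.
rewrite {1}[f]monalgE (big_morph _ (@shiftD w w') (shift0 w w')).
by apply: eq_bigr => k _; rewrite shiftU.
Qed.

Lemma shiftM a b u v f : shift a b (shift u v f) = shift (a * u)%M (v * b)%M f.
Proof.
rewrite [shift u v f]shiftE (big_morph _ (@shiftD a b) (shift0 a b)) shiftE.
by apply: eq_bigr => k _; rewrite shiftU !mulmA.
Qed.

Lemma shift1 f : shift 1%M 1%M f = f.
Proof. by rewrite shift_mul; exact: etrans (mulr1 _) (mul1r _). Qed.

Lemma mcoeff_shift w w' f u : (shift w w' f)@_(w * u * w')%M = f@_u.
Proof.
rewrite shiftE [in RHS](monalgE f) !raddf_sum /=; apply: eq_bigr => k _.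
rewrite !mcoeffU; congr (_ *+ nat_of_bool _).
by apply/eqP/eqP => [/word_shiftI|->].
Qed.

Lemma msupp_shift w w' f x : x \in msupp (shift w w' f) ->
  exists2 u, u \in msupp f & x = (w * u * w')%M.
Proof.
rewrite shift_mul => /msuppM_le [k1 [k2 [/msuppM_le [k3 [k4 [h3 h4 ->]]]]]].
move: h3; rewrite !msuppU1 !in_fset1 => /eqP -> /eqP -> ->.
by exists k4.
Qed.

End FreeAlgebra.

Section LeadingWords.
Context (K : fieldType) (n : nat) (sigma : rel (word n)).
Context (hsigma : word_ordering sigma).
Notation W := (word n).
Notation A := (freealg K n).
Implicit Types (f g h p q : A) (a b u v w : W) (c : K) (G H I S : set A).

Lemma Lw_max f u : u \in msupp f -> sigma u (Lw sigma f).
Proof.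
rewrite /Lw -(mem_sort sigma) => hu.
have := sort_sorted (wo_total hsigma) (msupp f).
rewrite (sorted_pairwise (wo_trans hsigma)).
case/lastP: (sort sigma (msupp f)) hu => // s x.
rewrite last_rcons mem_rcons inE pairwise_rcons.
case/predU1P=> [-> _|us /andP[/allP]].
  exact: wo_refl.
by move/(_ _ us).
Qed.

Lemma Lw_mem f : f != 0 -> Lw sigma f \in msupp f.
Proof.
rewrite -msupp_eq0 /Lw -(mem_sort sigma).
case/lastP e: (sort sigma (msupp f)) => [|s x] nz.
  case/negP: nz; apply/eqP/fsetP => x; rewrite in_fset0.
  by rewrite -(mem_sort sigma) e.
by rewrite last_rcons mem_rcons mem_head.
Qed.

Lemma Lw_eq f u : u \in msupp f -> (forall v, v \in msupp f -> sigma v u) ->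
  Lw sigma f = u.
Proof.
move=> hu hv; apply: (wo_anti hsigma); rewrite (Lw_max hu) hv //.
by apply: Lw_mem; apply: contraTneq hu => ->; rewrite msupp0.
Qed.

Lemma Lc_neq0 f : f != 0 -> Lc sigma f != 0.
Proof. by move/Lw_mem; rewrite /Lc mcoeff_neq0. Qed.

Lemma Lw_tail p u : p != 0 ->
  u \in msupp (<< Lw sigma p >> - (Lc sigma p)^-1 *: p) ->
  wlt sigma u (Lw sigma p).
Proof.
move=> nzp hu; have nzc := Lc_neq0 nzp; rewrite /wlt andbC.
have nu : u != Lw sigma p.
  apply: contraTneq hu => ->; rewrite -mcoeff_eq0 mcoeffB mcoeffUU.
  by rewrite [(_ *: _)@__]mcoeffZ mulVf // subrr.
rewrite nu /=; move: hu => /(fsubsetP (msuppB_le _ _)).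
rewrite in_fsetU msuppU1 in_fset1 (negPf nu) /= => /(fsubsetP (msuppZ_le _ _)).
exact: Lw_max.
Qed.

Lemma msupp_shift_le w w' f u :
  u \in msupp (shift w w' f) -> sigma u (w * Lw sigma f * w')%M.
Proof. by case/msupp_shift => v /Lw_max hv ->; apply: wle_shift. Qed.

Inductive span (B : set A) : A -> Prop :=
| span0 : span B 0
| spanZD c g f : B g -> span B f -> span B (c *: g + f).

Lemma span_gen (B : set A) f : B f -> span B f.
Proof.
by move=> hb; rewrite -[f]addr0 -[f]scale1r; apply: spanZD hb (span0 B).
Qed.

Lemma spanD (B : set A) f g : span B f -> span B g -> span B (f + g).
Proof.
by elim=> [|c h f' hb _ IH] hg; rewrite ?add0r // -addrA; apply: spanZD (IH hg).
Qed.

Lemma spanZ (B : set A) c f : span B f -> span B (c *: f).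
Proof.
elim=> [|d h f' hb _ IH]; first by rewrite scaler0; apply: span0.
by rewrite scalerDr scalerA; apply: spanZD.
Qed.

Lemma spanB (B : set A) f g : span B f -> span B g -> span B (f - g).
Proof. by move=> hf hg; rewrite -scaleN1r; apply/spanD/spanZ. Qed.

Lemma span_sum (B : set A) (T : eqType) (s : seq T) (F : T -> A) :
  (forall x, x \in s -> span B (F x)) -> span B (\sum_(x <- s) F x).
Proof.
move=> hF; rewrite big_seq_cond; apply: big_ind => [|f g|x].
- exact: span0.
- exact: spanD.
by rewrite andbT => /hF.
Qed.

Lemma span_ind_lin (B : set A) (P : A -> Prop) :
  P 0 -> (forall f g, P f -> P g -> P (f + g)) ->
  (forall c f, P f -> P (c *: f)) -> (forall f, B f -> P f) ->
  forall f, span B f -> P f.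
Proof.
by move=> P0 PD PZ PB f; elim=> // c g h hg _ hh; apply: PD => //; apply/PZ/PB.
Qed.

Definition rep H (P : pred W) : A -> Prop :=
  span [set f | exists h w w',
    [/\ H h, P (w * Lw sigma h * w')%M & f = shift w w' h]].

Lemma rep_gen H (P : pred W) h w w' :
  H h -> P (w * Lw sigma h * w')%M -> rep H P (shift w w' h).
Proof. by move=> hh hP; apply: span_gen; exists h, w, w'. Qed.

Lemma rep_shift H (P Q : pred W) a b f :
  (forall v, P v -> Q (a * v * b)%M) -> rep H P f -> rep H Q (shift a b f).
Proof.
move=> PQ; elim/span_ind_lin => [|g h hg hh|c g hg|_ [h [w [w' [hh hP ->]]]]].
- by rewrite shift0; apply: span0.
- by rewrite shiftD; apply: spanD.
- by rewrite shiftZ; apply: spanZ.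
rewrite shiftM; apply: rep_gen => //.
by have := PQ _ hP; rewrite !mulmA.
Qed.

Lemma rep_sub H (P Q : pred W) f :
  (forall v, P v -> Q v) -> rep H P f -> rep H Q f.
Proof.
move=> PQ; rewrite -{2}[f]shift1; apply: rep_shift => v.
by rewrite mul1m mulm1; apply: PQ.
Qed.

Lemma rep_mul H (P : pred W) h q1 q2 : H h ->
  (forall u v, u \in msupp q1 -> v \in msupp q2 -> P (u * Lw sigma h * v)%M) ->
  rep H P (q1 * h * q2).
Proof.
move=> hh hP.
pose F q := q * h * q2; pose G u q := << u >> * h * q.
have FD : {morph F : f g / f + g} by move=> f g; rewrite /F !mulrDl.
have F0 : F 0 = 0 by rewrite /F !mul0r.
have GD u : {morph G u : f g / f + g} by move=> f g; rewrite /G mulrDr.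
have G0 u : G u 0 = 0 by rewrite /G mulr0.
have FZ c u : F (c *: << u >>) = c *: G u q2 by rewrite /F /G -!scalerAl.
rewrite -/(F q1) [q1]malg_sumZ (big_morph F FD F0).
apply: span_sum => u hu; rewrite FZ; apply: spanZ.
rewrite [q2]malg_sumZ (big_morph _ (GD u) (G0 u)); apply: span_sum => v hv.
by rewrite /G mulrZ -shift_mul; apply/spanZ/rep_gen/hP.
Qed.

Lemma rep_msupp H (P : pred W) f :
  (forall u v, sigma u v -> P v -> P u) -> rep H P f ->
  forall u, u \in msupp f -> P u.
Proof.
move=> Pdown.
elim/span_ind_lin => [|g h hg hh|c g hg|_ [h [w [w' [_ hP ->]]]]] u.
- by rewrite msupp0.
- by move/(fsubsetP (msuppD_le _ _)); rewrite in_fsetU => /orP[/hg|/hh].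
- by move/(fsubsetP (msuppZ_le _ _))/hg.
by move/msupp_shift_le/Pdown; apply.
Qed.

Definition spair p a a' q b b' : A :=
  (Lc sigma p)^-1 *: shift a a' p - (Lc sigma q)^-1 *: shift b b' q.

Lemma spairC p a a' q b b' : spair p a a' q b b' = - spair q b b' p a a'.
Proof. by rewrite /spair opprB. Qed.

Lemma shift_spair w w' p a a' q b b' :
  shift w w' (spair p a a' q b b') =
  spair p (w * a)%M (a' * w')%M q (w * b)%M (b' * w')%M.
Proof. by rewrite /spair shiftB; congr (_ - _); rewrite shiftZ shiftM. Qed.

Lemma mcoeff_shift_Lc p a a' : p != 0 ->
  ((Lc sigma p)^-1 *: shift a a' p)@_(a * Lw sigma p * a')%M = 1.
Proof.
by move=> nzp; rewrite [LHS]mcoeffZ mcoeff_shift mulVf // Lc_neq0.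
Qed.

Lemma spair_msupp p a a' q b b' : p != 0 -> q != 0 ->
  (a * Lw sigma p * a')%M = (b * Lw sigma q * b')%M ->
  forall u, u \in msupp (spair p a a' q b b') ->
  wlt sigma u (a * Lw sigma p * a')%M.
Proof.
move=> nzp nzq e u hu; rewrite /wlt andbC.
have -> /= : u != (a * Lw sigma p * a')%M.
  apply: contraTneq hu => ->; rewrite -mcoeff_eq0 mcoeffB {2}e.
  by rewrite !mcoeff_shift_Lc // subrr.
move: hu => /(fsubsetP (msuppB_le _ _)); rewrite in_fsetU.
move=> /orP[] /(fsubsetP (msuppZ_le _ _)) /msupp_shift_le //.
by rewrite e.
Qed.

(* Writes the S-polynomial of disjoint occurrences in terms of the tails
   lp - c p and lq - d q, whose words are smaller than lp and lq. *)
Lemma disjoint_identity (B : lalgType K)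
    (scalerr : forall (x : B) c (y : B), x * (c *: y) = c *: (x * y))
    (al be mu p q lp lq : B) c d :
  c *: (al * p * (mu * lq * be)) - d *: (al * lp * mu * q * be) =
  c *: (al * p * (mu * (lq - d *: q) * be)) -
  d *: (al * (lp - c *: p) * mu * q * be).
Proof.
rewrite !(mulrBr, mulrBl, scalerr, =^~ scalerAl, scalerBr) !scalerA !mulrA.
by rewrite [d * c]mulrC opprB addrA subrK.
Qed.

Lemma rep_disjoint H p q a m b : H p -> H q -> p != 0 -> q != 0 ->
  rep H (wlt sigma ^~ (a * Lw sigma p * (m * Lw sigma q * b))%M)
    (spair p a (m * Lw sigma q * b)%M q (a * Lw sigma p * m)%M b).
Proof.
move=> hp hq nzp nzq; set L := (_ * (m * _ * b))%M.
have eU u v w : << (u * v * w)%M >> = << u >> * << v >> * << w >> :> A.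
  by rewrite -shift_mul shiftU.
rewrite /spair [shift a _ p]shift_mul [shift _ b q]shift_mul !eU.
rewrite (disjoint_identity (@mulrZ K n) << a >> << b >> << m >> p q
  << Lw sigma p >> << Lw sigma q >> (Lc sigma p)^-1 (Lc sigma q)^-1).
apply: spanB; apply: spanZ; apply: (@rep_mul H (wlt sigma ^~ L)) => // u v.
  rewrite msuppU1 in_fset1 => /eqP ->.
  rewrite -shift_mul => /msupp_shift [x hx ->].
  have := wlt_shift hsigma (a * Lw sigma p * m)%M b (Lw_tail nzq hx).
  by rewrite /L !mulmA.
rewrite -shift_mul => /msupp_shift [x hx ->].
rewrite msuppU1 in_fset1 => /eqP ->.
have := wlt_shift hsigma a (m * Lw sigma q * b)%M (Lw_tail nzp hx).
by rewrite /L !mulmA.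
Qed.

End LeadingWords.

Section Criterion.
Context (K : fieldType) (n : nat) (sigma : rel (word n)).
Context (hsigma : word_ordering sigma).
Notation W := (word n).
Notation A := (freealg K n).
Notation Lw := (Lw sigma).
Notation Lc := (Lc sigma).
Notation wlt := (wlt sigma).
Notation rep := (rep sigma).
Notation spair := (spair sigma).
Implicit Types (f g h p q : A) (a b u v w : W) (c : K) (H I S : set A).

Lemma rep_spair_multiple H p q a a' b b' u u' :
  rep H (wlt ^~ (a * Lw p * a')%M) (spair p a a' q b b') ->
  rep H (wlt ^~ ((u * a) * Lw p * (a' * u'))%M)
    (spair p (u * a)%M (a' * u')%M q (u * b)%M (b' * u')%M).
Proof.
rewrite -shift_spair; apply: rep_shift => v hv.
by have := wlt_shift hsigma u u' hv; rewrite !mulmA.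
Qed.

Lemma rep_spairC H p q a a' b b' :
  (a * Lw p * a')%M = (b * Lw q * b')%M ->
  rep H (wlt ^~ (a * Lw p * a')%M) (spair p a a' q b b') ->
  rep H (wlt ^~ (b * Lw q * b')%M) (spair q b b' p a a').
Proof. by move=> <- hs; rewrite spairC -scaleN1r; apply: spanZ. Qed.

Lemma spair_id H P p a a' : rep H P (spair p a a' p a a').
Proof. by rewrite /spair subrr; apply: span0. Qed.

Lemma rep_spair_contained H p q u v w w' :
  (rep H (wlt ^~ (Lw p)) (spair p 1%M 1%M q w w')) ->
  rep H (wlt ^~ (u * Lw p * v)%M) (spair p u v q (u * w)%M (w' * v)%M).
Proof.
move=> h; have := @rep_spair_multiple H p q 1%M 1%M w w' u v.
by rewrite !mulm1 !mul1m; apply.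
Qed.

Lemma rep_spair_overlap H p q u v w w' :
  rep H (wlt ^~ (Lw p * w')%M) (spair p 1%M w' q w 1%M) ->
  rep H (wlt ^~ (u * Lw p * (w' * v))%M) (spair p u (w' * v)%M q (u * w)%M v).
Proof.
move=> h; have := @rep_spair_multiple H p q 1%M w' w 1%M u v.
by rewrite !mulm1 !mul1m; apply.
Qed.

(* After cancelling common prefixes and suffixes, a pair of occurrences is a
   containment, a proper overlap or disjoint. *)
Lemma rep_spair H :
  (forall h, H h -> h != 0) -> (forall h, H h -> Lw h <> 1%M) ->
  (forall p q w w', H p -> H q -> p <> q -> Lw p = (w * Lw q * w')%M ->
     rep H (wlt ^~ (Lw p)) (spair p 1%M 1%M q w w')) ->
  (forall p q w w', H p -> H q -> (p = q -> w <> 1%M) ->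
     (Lw p * w')%M = (w * Lw q)%M -> (size w < size (Lw p))%N ->
     rep H (wlt ^~ (Lw p * w')%M) (spair p 1%M w' q w 1%M)) ->
  forall p q a a' b b', H p -> H q ->
    (a * Lw p * a')%M = (b * Lw q * b')%M ->
    rep H (wlt ^~ (a * Lw p * a')%M) (spair p a a' q b b').
Proof.
move=> nz n1 hcont hover.
have left p q a a' b b' : H p -> H q -> (size a <= size b)%N ->
    (a * Lw p * a')%M = (b * Lw q * b')%M ->
    rep H (wlt ^~ (a * Lw p * a')%M) (spair p a a' q b b').
  move=> hp hq lab e.
  have [|z [ebz e']] := @word_levi _ a (Lw p * a')%M b (Lw q * b')%M _ lab.
    by rewrite !mulmA.
  case: (leqP (size a') (size b')) => lab'.
    have [||z' [epz ebz']] := @word_levi _ (z * Lw q)%M b' (Lw p) a'.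
    - by rewrite e' mulmA.
    - have := congr1 (fun m : W => size m) e'.
      by rewrite !word_size_mul; lia.
    rewrite ebz ebz'; apply: rep_spair_contained.
    case: (pselect (p = q)) => [epq|npq]; last exact: hcont.
    move/(congr1 (fun m : W => size m)): epz; rewrite -epq !word_size_mul => es.
    have -> : z = 1%M by apply: word_size_eq0; lia.
    have -> : z' = 1%M by apply: word_size_eq0; lia.
    exact: spair_id.
  have [||z' [ebz' epz]] := @word_levi _ (Lw p) a' (z * Lw q)%M b'.
  - by rewrite e' mulmA.
  - have := congr1 (fun m : W => size m) e'.
    by rewrite !word_size_mul; lia.
  have [lz|lz] := ltnP (size z) (size (Lw p)).
    rewrite epz ebz; apply: rep_spair_overlap.
    apply: hover => // epq ez; move: lab'; rewrite epz word_size_mul.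
    move/(congr1 (fun m : W => size m)): ebz'; rewrite -epq ez !word_size_mul.
    by rewrite word_size1; lia.
  have [|m [ez ea]] := @word_levi _ (Lw p) z' z (Lw q) _ lz.
    exact: esym ebz'.
  by rewrite epz ebz ez ea mulmA; apply: rep_disjoint => //; apply: nz.
move=> p q a a' b b' hp hq e; case: (leqP (size a) (size b)) => lab.
  exact: left.
by apply: rep_spairC; [|apply: left => //; apply: ltnW].
Qed.

Lemma rep_top H p M f a a' : (forall h, H h -> h != 0) -> H p ->
  (forall q b b', H q -> (b * Lw q * b')%M = M ->
     rep H (wlt ^~ M) (spair p a a' q b b')) ->
  M = (a * Lw p * a')%M ->
  rep H (sigma ^~ M) f ->
  rep H (wlt ^~ M) (f - f@_M *: ((Lc p)^-1 *: shift a a' p)).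
Proof.
move=> nz hp hs eM.
set t := _ *: shift a a' p.
have spairE q b b' : spair p a a' q b b' = t - (Lc q)^-1 *: shift b b' q by [].
clearbody t.
elim/span_ind_lin => [|g h hg hh|c g hg|_ [q [w [w' [hq hw ->]]]]].
- by rewrite mcoeff0 scale0r subrr; apply: span0.
- by rewrite mcoeffD scalerDl opprD addrACA; exact: spanD hg hh.
- by rewrite [(c *: g)@__]mcoeffZ -scalerA -scalerBr; exact: spanZ hg.
have [eq|lt] := wle_eqVlt hw.
  have -> : shift w w' q - (shift w w' q)@_M *: t =
      (- Lc q) *: spair p a a' q w w'.
    have -> : (shift w w' q)@_M = Lc q by rewrite -eq mcoeff_shift.
    rewrite spairE scalerBr scalerA mulNr mulfV; last exact/Lc_neq0/nz.
    by rewrite scaleN1r opprK scaleNr addrC.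
  exact: spanZ (hs _ _ _ hq eq).
have -> : (shift w w' q)@_M = 0.
  apply/eqP; rewrite mcoeff_eq0; apply/negP => /(msupp_shift_le hsigma).
  by move=> /(wle_lt_trans hsigma) /(_ lt); rewrite wlt_irr.
by rewrite scale0r subr0; apply: rep_gen.
Qed.

Lemma rep_wle H M1 M2 f :
  sigma M1 M2 -> rep H (sigma ^~ M1) f -> rep H (sigma ^~ M2) f.
Proof. by move=> h12; apply: rep_sub => v hv; apply: wo_trans h12. Qed.

Lemma rep_wlt_wle H M f : rep H (wlt ^~ M) f ->
  f = 0 \/ exists2 M', wlt M' M & rep H (sigma ^~ M') f.
Proof.
elim/span_ind_lin => [|g h hg hh|c g hg|_ [q [w [w' [hq hw ->]]]]].
- by left.
- case: hg => [->|[M1 h1 hg]]; first by rewrite add0r.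
  case: hh => [->|[M2 h2 hh]]; first by rewrite addr0; right; exists M1.
  right; have [h12|h21] := orP (wo_total hsigma M1 M2).
    exists M2 => //; exact: spanD (rep_wle h12 hg) hh.
  exists M1 => //; exact: spanD hg (rep_wle h21 hh).
- case: hg => [->|[M1 h1 hg]]; first by left; rewrite scaler0.
  by right; exists M1 => //; exact: spanZ hg.
by right; exists (w * Lw q * w')%M => //; apply: rep_gen => //; apply: wo_refl.
Qed.

Definition divisible H u : Prop :=
  exists h w w', [/\ H h, h != 0 & u = (w * Lw h * w')%M].

Lemma rep_Lw_divisible H : (forall h, H h -> h != 0) ->
  (forall p q a a' b b', H p -> H q ->
     (a * Lw p * a')%M = (b * Lw q * b')%M ->
     rep H (wlt ^~ (a * Lw p * a')%M) (spair p a a' q b b')) ->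
  forall M f, rep H (sigma ^~ M) f -> f != 0 -> divisible H (Lw f).
Proof.
move=> nz hs M f; elim/(wo_ind hsigma): M f => M IH f hf nzf.
have lower : rep H (wlt ^~ M) f -> divisible H (Lw f).
  case/rep_wlt_wle => [f0|[M' lt hf']]; first by rewrite f0 eqxx in nzf.
  exact: IH hf' nzf.
case: (pselect (divisible H M)) => [[p [a [a' [hp nzp eM]]]]|ndiv]; last first.
  apply: lower; move: hf.
  elim/span_ind_lin => [|g h||_ [q [w [w' [hq hw ->]]]]].
  - exact: span0.
  - exact: spanD.
  - by move=> c g; apply: spanZ.
  have [e|lt] := wle_eqVlt hw; last exact: rep_gen.
  by case: ndiv; exists q, w, w'; split => //; apply: nz.
have [f0|nf0] := eqVneq f@_M 0.
  apply: lower; have := @rep_top H p M f a a' nz hp _ eM hf.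
  rewrite f0 scale0r subr0; apply => q b b' hq e.
  by rewrite eM; apply: hs; rewrite // -eM e.
exists p, a, a'; split => //; rewrite -eM; apply: Lw_eq => //.
  by rewrite -mcoeff_neq0.
apply: (rep_msupp hsigma _ hf) => u v uv vM; exact: wo_trans vM.
Qed.

Lemma twosidedZ I c f : twosided_ideal I -> I f -> I (c *: f).
Proof.
case=> _ _ IM hf; rewrite -mul_malgC -[_ * f]mulr1; exact: IM.
Qed.

Lemma twosidedB I f g : twosided_ideal I -> I f -> I g -> I (f - g).
Proof.
move=> hI hf hg; rewrite -scaleN1r; case: (hI) => _ ID _.
by apply: ID => //; apply: twosidedZ.
Qed.

Lemma ideal_gen_twosided S : twosided_ideal (ideal_gen S).
Proof.
split=> [J [[]]//|f g hf hg J hJ|f g h hg J hJ]; case: (hJ) => -[J0 JD JM] _.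
  by apply: JD; [apply: hf|apply: hg].
by apply: JM; apply: hg.
Qed.

Lemma ideal_gen_sub S : S `<=` ideal_gen S.
Proof. exact: sub_gen_smallest. Qed.

Lemma ideal_gen_min S I : twosided_ideal I -> S `<=` I -> ideal_gen S `<=` I.
Proof. by move=> hI hS; apply: smallest_sub. Qed.

Lemma rep_ideal_gen H f : ideal_gen H f -> exists M, rep H (sigma ^~ M) f.
Proof.
suff : rep H predT f -> exists M, rep H (sigma ^~ M) f.
  move=> + hf; apply; move: f hf; apply: ideal_gen_min => [|h hh]; last first.
    by rewrite -[h]shift1; apply: rep_gen.
  split=> [|f g|f g h]; [exact: span0|exact: spanD|].
  elim/span_ind_lin => [|g1 g2 h1 h2|c g1 h1|_ [q [w [w' [hq hw ->]]]]].
  - by rewrite mulr0 mul0r; apply: span0.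
  - by rewrite mulrDr mulrDl; exact: spanD h1 h2.
  - by rewrite mulrZ -scalerAl; exact: spanZ h1.
  have assoc (B : nzRingType) (x y z s t : B) :
    x * (y * z * s) * t = (x * y) * z * (s * t) by rewrite !mulrA.
  rewrite shift_mul assoc.
  exact: rep_mul.
elim/span_ind_lin =>
  [|g h [M1 hg] [M2 hh]|c g [M hg]|_ [q [w [w' [hq hw ->]]]]].
- by exists 1%M; apply: span0.
- have [h12|h21] := orP (wo_total hsigma M1 M2).
    exists M2; exact: spanD (rep_wle h12 hg) hh.
  exists M1; exact: spanD hg (rep_wle h21 hh).
- by exists M; exact: spanZ hg.
by exists (w * Lw q * w')%M; apply: rep_gen => //; apply: wo_refl.
Qed.

Lemma divisible_shift H u w w' : divisible H u -> divisible H (w * u * w')%M.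
Proof.
case=> h [v [v' [hh nz ->]]]; exists h, (w * v)%M, (v' * w')%M.
by rewrite !mulmA.
Qed.

Lemma ideal_gen_Lw_set_divisible H f u :
  ideal_gen (Lw_set sigma H) f -> u \in msupp f -> divisible H u.
Proof.
move=> hf; move: u; move: f hf; apply: ideal_gen_min => [|_ [h [hh nz] <-] u].
  split=> [u|f g hf hg u|f g h hg u]; first by rewrite msupp0.
    by move/(fsubsetP (msuppD_le _ _)); rewrite in_fsetU => /orP[/hf|/hg].
  move=> /msuppM_le [k1 [k2 [/msuppM_le [k3 [k4 [_ h4 ->]]] _ ->]]].
  exact/divisible_shift/hg.
rewrite msuppU1 in_fset1 => /eqP ->; exists h, 1%M, 1%M.
by rewrite mul1m mulm1.
Qed.

Lemma groebner_basisP I H : H `<=` I ->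
  groebner_basis sigma I H <-> (forall f, I f -> f != 0 -> divisible H (Lw f)).
Proof.
move=> HI; split=> [[_ e] f hf nz|hdiv].
  apply: (@ideal_gen_Lw_set_divisible H << Lw f >>); last first.
    by rewrite msuppU1 in_fset1.
  by rewrite e; apply: ideal_gen_sub; exists f.
split => //; apply/seteqP; split; apply: ideal_gen_min;
  try exact: ideal_gen_twosided.
  move=> _ [h [hh nz] <-]; apply: ideal_gen_sub.
  by exists h => //; split => //; apply: HI.
move=> _ [f [hf nz] <-]; have [h [w [w' [hh nzh ->]]]] := hdiv f hf nz.
have [_ _ IM] := ideal_gen_twosided (Lw_set sigma H).
rewrite -shiftU shift_mul; apply: IM; apply: ideal_gen_sub.
by exists h.
Qed.

End Criterion.

Section Division.
Context (K : fieldType) (n : nat) (sigma : rel (word n)).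
Context (hsigma : word_ordering sigma).
Notation W := (word n).
Notation A := (freealg K n).
Notation Lw := (Lw sigma).
Notation wlt := (wlt sigma).
Notation rep := (rep sigma).
Implicit Types (f p v r : A) (G : seq A) (H I : set A) (M u : W).

Lemma division_rep G H M p v r : [set` G] `<=` H ->
  (forall u, u \in msupp v -> wlt u M) -> division sigma G p v r ->
  rep H (wlt ^~ M) (v + p - r) /\
  ((forall u, u \in msupp p -> wlt u M) -> forall u, u \in msupp r -> wlt u M).
Proof.
move=> GH + hdiv; elim: hdiv =>
  {p v r} [p|p v r i w w' nzv hi eLw _ _ IH|p v r nzv _ _ IH] hv.
- by split => //; rewrite add0r subrr; apply: span0.
- rewrite -shift_mul in IH *; set t := _ *: _ in IH.
  have hLw : wlt (w * Lw G`_i * w')%M M by rewrite -eLw; apply/hv/Lw_mem.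
  have [|h1 h2] := IH.
    move=> u /(fsubsetP (msuppB_le _ _)); rewrite in_fsetU => /orP[/hv //|].
    move=> /(fsubsetP (msuppZ_le _ _)) /(msupp_shift_le hsigma) ule.
    exact: wle_lt_trans hLw.
  split => //; have -> : v + p - r = (v - t + p - r) + t.
    by rewrite [RHS]addrAC (addrAC (v - t)) subrK.
  have hG : H G`_i by apply: GH; apply: mem_nth.
  exact: spanD h1 (spanZ _ (rep_gen hG hLw)).
have hLw : wlt (Lw v) M by apply/hv/Lw_mem.
have hm u : u \in msupp << Lc sigma v *g Lw v >> -> wlt u M.
  by move/(fsubsetP msuppU_le); rewrite in_fset1 => /eqP ->.
have [|h1 h2] := IH.
  by move=> u /(fsubsetP (msuppB_le _ _)); rewrite in_fsetU => /orP[/hv|/hm].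
split=> [|hp]; first by move: h1; rewrite [p + _]addrC addrA subrK.
by apply: h2 => u /(fsubsetP (msuppD_le _ _)); rewrite in_fsetU => /orP[/hp|/hm].
Qed.

Lemma division_ideal G I p v r : twosided_ideal I -> [set` G] `<=` I ->
  division sigma G p v r -> I (p + v) -> I r.
Proof.
move=> hI GI; elim=> {p v r} [p|p v r i w w' _ hi _ _ _ IH|p v r _ _ _ IH] hpv.
- by rewrite addr0 in hpv.
- apply: IH; rewrite addrA; apply: twosidedB => //; apply: twosidedZ => //.
  by case: hI => _ _; apply; apply: GI; apply: mem_nth.
by apply: IH; rewrite addrACA subrr addr0.
Qed.

Lemma division_irreducible G p v r : division sigma G p v r ->
  (forall u, u \in msupp p -> ~ divisible sigma [set` G] u) ->
  forall u, u \in msupp r -> ~ divisible sigma [set` G] u.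
Proof.
elim=> {p v r} [//|p v r i w w' _ _ _ _ _ IH //|p v r _ hirr _ IH] hp.
apply: IH => u /(fsubsetP (msuppD_le _ _)); rewrite in_fsetU => /orP[/hp //|].
move/(fsubsetP msuppU_le); rewrite in_fset1 => /eqP -> [h [w [w' [hh _ e]]]].
apply: (hirr (index h G) w w'); first by rewrite index_mem.
by rewrite nth_index.
Qed.

End Division.

Section Obstructions.
Context (K : fieldType) (n : nat) (sigma : rel (word n)).
Context (hsigma : word_ordering sigma).
Notation W := (word n).
Notation A := (freealg K n).
Implicit Types (G : seq A) (a b : W).

Lemma Spoly_obs G i a a' j b b' :
  Spoly G (obs sigma G i a a' j b b') = spair sigma G`_i a a' G`_j b b'.
Proof. by rewrite SpolyE /spair !shift_mul. Qed.

Lemma mcoeff_obs G i a a' j b b' x :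
  (obs sigma G i a a' j b b')@_x =
  (Lc sigma G`_i)^-1 * ((i, a, a') == x)%:R -
  (Lc sigma G`_j)^-1 * ((j, b, b') == x)%:R.
Proof.
rewrite mcoeffB; congr (_ - _); apply: (etrans (mcoeffZ _ _ _)); congr (_ * _);
  exact: mcoeffU.
Qed.

Lemma msupp_obs G i a a' j b b' x : x \in msupp (obs sigma G i a a' j b b') ->
  x = (i, a, a') \/ x = (j, b, b').
Proof.
rewrite -mcoeff_neq0 mcoeff_obs.
have [<-|_] := eqVneq (i, a, a') x; first by left.
have [<-|_] := eqVneq (j, b, b') x; first by right.
by rewrite !mulr0 subrr eqxx.
Qed.

Lemma msupp_obsr G i a a' j b b' : G`_j != 0 ->
  obs sigma G i a a' j b b' != 0 ->
  (j, b, b') \in msupp (obs sigma G i a a' j b b').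
Proof.
move=> nz; have [[-> -> ->]|ne] := eqVneq (i, a, a') (j, b, b').
  by rewrite /obs subrr eqxx.
rewrite -mcoeff_neq0 mcoeff_obs (negPf ne) eqxx mulr0 mulr1 sub0r oppr_eq0 => _.
by rewrite invr_eq0 Lc_neq0.
Qed.

Lemma obs_neq0 G i a a' j b b' : G`_i != 0 -> (i, a, a') != (j, b, b') ->
  obs sigma G i a a' j b b' != 0.
Proof.
move=> nz ne; apply/eqP => /(congr1 (fun o : freebimod K n => o@_(i, a, a'))).
rewrite /= mcoeff_obs mcoeff0 eqxx eq_sym (negPf ne) mulr0 subr0 mulr1.
by apply/eqP; rewrite invr_eq0 Lc_neq0.
Qed.

Lemma nontrivialI G i a a' j b b' : (i < size G)%N -> (j < size G)%N ->
  G`_i != 0 -> (i, a, a') != (j, b, b') ->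
  (a * Lw sigma G`_i * a')%M = (b * Lw sigma G`_j * b')%M ->
  overlap sigma G i a a' j b b' ->
  (if i == j then [/\ a = 1%M, b' = 1%M, b <> 1%M & a' <> 1%M]
   else [\/ a' = 1%M /\ b = 1%M, a = 1%M /\ b' = 1%M,
            b = 1%M /\ b' = 1%M | a = 1%M /\ a' = 1%M]) ->
  nontrivial sigma G i a a' j b b'.
Proof.
by move=> hi hj nz ne e hov hform; do 2!split => //; apply: obs_neq0.
Qed.

(* An obstruction determines its common word although not its presentation: in
   characteristic 2 the two terms can be exchanged when i = j. *)
Lemma obs_lcm G i a a' j b b' k c c' l d d' :
  obs sigma G i a a' j b b' != 0 ->
  obs sigma G i a a' j b b' = obs sigma G k c c' l d d' ->
  (a * Lw sigma G`_i * a')%M = (b * Lw sigma G`_j * b')%M ->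
  (c * Lw sigma G`_k * c')%M = (d * Lw sigma G`_l * d')%M ->
  (a * Lw sigma G`_i * a')%M = (c * Lw sigma G`_k * c')%M.
Proof.
pose L (x : nat * W * W) := (x.1.2 * Lw sigma G`_x.1.1 * x.2)%M.
move=> nz e e1 e2.
have [x hx] : exists x, x \in msupp (obs sigma G i a a' j b b').
  apply: contrapT => no; case/negP: nz; apply/eqP/malgP => x.
  rewrite [RHS]mcoeff0; apply: mcoeff_outdom.
  by apply/negP => hx; apply: no; exists x.
have -> : (a * Lw sigma G`_i * a')%M = L x.
  by case: (msupp_obs hx) => ->.
by rewrite e in hx; case: (msupp_obs hx) => ->.
Qed.

Lemma obs_nth G G' i a a' j b b' : G`_i = G'`_i -> G`_j = G'`_j ->
  obs sigma G i a a' j b b' = obs sigma G' i a a' j b b'.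
Proof. by move=> ei ej; rewrite /obs ei ej. Qed.

Lemma rep_no_overlap (H : set A) G i a a' j b b' :
  H G`_i -> H G`_j -> G`_i != 0 -> G`_j != 0 ->
  Lw sigma G`_i <> 1%M -> Lw sigma G`_j <> 1%M ->
  (a * Lw sigma G`_i * a')%M = (b * Lw sigma G`_j * b')%M ->
  ~ overlap sigma G i a a' j b b' ->
  rep sigma H (wlt sigma ^~ (a * Lw sigma G`_i * a')%M)
    (spair sigma G`_i a a' G`_j b b').
Proof.
move=> hi hj nzi nzj ni nj e nov.
have size_gt0 (u : W) : u <> 1%M -> (0 < size u)%N.
  by move=> u1; case: posnP => // /word_size_eq0.
have {size_gt0 ni nj} [li lj] := conj (size_gt0 _ ni) (size_gt0 _ nj).
have [ab|ba] : (size a + size (Lw sigma G`_i) <= size b)%N \/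
    (size b + size (Lw sigma G`_j) <= size a)%N.
- apply: contrapT => no; apply: nov; exists (maxn (size a) (size b)).
  by split; lia.
- have [||m [eb ea]] :=
    @word_levi _ (a * Lw sigma G`_i)%M a' b (Lw sigma G`_j * b')%M.
  + by rewrite e mulmA.
  + by rewrite word_size_mul.
  by rewrite mulmA in ea; rewrite eb ea; apply: rep_disjoint.
have [||m [ea eb]] :=
  @word_levi _ (b * Lw sigma G`_j)%M b' a (Lw sigma G`_i * a')%M.
- by rewrite -e mulmA.
- by rewrite word_size_mul.
apply: rep_spairC; first exact: esym e.
by rewrite mulmA in eb; rewrite ea eb; apply: rep_disjoint.
Qed.

Lemma obs_cat G s i a a' j b b' : (i < size G)%N -> (j < size G)%N ->
  obs sigma (G ++ s) i a a' j b b' = obs sigma G i a a' j b b'.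
Proof. by move=> hi hj; rewrite /obs !nth_cat hi hj. Qed.

Lemma nontrivial_cat G s i a a' j b b' : (i < size G)%N -> (j < size G)%N ->
  nontrivial sigma (G ++ s) i a a' j b b' <-> nontrivial sigma G i a a' j b b'.
Proof.
move=> hi hj; rewrite /nontrivial /is_obstruction /overlap obs_cat //.
rewrite !nth_cat hi hj size_cat.
by split=> -[[? ? ? ?] ? ?]; do 2!split => //; rewrite ltn_addr.
Qed.

Lemma NTObs_cat G s i j o : (i < size G)%N -> (j < size G)%N ->
  NTObs sigma (G ++ s) i j o -> NTObs sigma G i j o.
Proof.
move=> hi hj [a [a' [b [b' [/(nontrivial_cat _ _ _ _ _ hi hj) nt ->]]]]].
by exists a, a', b, b'; rewrite obs_cat.
Qed.

Lemma nontrivial_size G i a a' j b b' : nontrivial sigma G i a a' j b b' ->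
  let N := (size (Lw sigma G`_i) + size (Lw sigma G`_j))%N in
  [/\ size a <= N, size a' <= N, size b <= N & size b' <= N]%N.
Proof.
move=> [[_ _ e _] [p [hp1 hp2]] hform] /=.
have := congr1 (fun m : W => size m) e; rewrite !word_size_mul => {}e.
move: hform hp1 hp2 e; case: ifP => [/eqP <- [-> -> _ _]|_].
  by rewrite !word_size1 -!(@fdegE 'I_n); split; lia.
by case=> -[-> ->]; rewrite !word_size1 -!(@fdegE 'I_n); split; lia.
Qed.

Lemma finite_words N : finite_set [set w : W | (size w <= N)%N].
Proof.
have hf : finite_set [set: N.-bseq 'I_n] by exact: finite_finset.
apply: sub_finite_set (finite_image (fun s : N.-bseq 'I_n => FMonom s) hf).
by move=> w hw; exists (Bseq hw) => //=; apply: fmK.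
Qed.

Lemma finite_NTObs G i j : finite_set (NTObs sigma G i j).
Proof.
pose N := (size (Lw sigma G`_i) + size (Lw sigma G`_j))%N.
pose B := [set w : W | (size w <= N)%N].
have hB : finite_set ((B `*` B) `*` (B `*` B)).
  by do 2!apply: finite_setX; exact: finite_words.
pose F (x : (W * W) * (W * W)) := obs sigma G i x.1.1 x.1.2 j x.2.1 x.2.2.
apply: sub_finite_set (finite_image F hB).
move=> _ [a [a' [b [b' [nt ->]]]]]; exists ((a, a'), (b, b')) => //.
by have [? ? ? ?] := nontrivial_size nt.
Qed.

Lemma finite_NTObs_upto G N : finite_set
  [set o | exists i j : nat, (i <= j < N)%N /\ NTObs sigma G i j o].
Proof.
pose U := \bigcup_(i in `I_N) \bigcup_(j in `I_N) NTObs sigma G i j.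
apply: (@sub_finite_set _ _ U) => [o [i [j [/andP[ij jN] ho]]]|].
  by exists i; [exact: leq_ltn_trans jN|exists j].
apply: bigcup_finite => [|i _]; first exact: finite_II.
by apply: bigcup_finite => [|j _]; [exact: finite_II|exact: finite_NTObs].
Qed.

Lemma Spoly_ideal G I o : twosided_ideal I -> [set` G] `<=` I -> I (Spoly G o).
Proof.
move=> hI GI; have [I0 ID IM] := hI.
rewrite /Spoly; elim/big_ind: _ => // b _; apply: (twosidedZ _ hI); apply: IM.
have [hb|hb] := ltnP b.1.1 (size G); last by rewrite nth_default.
by apply: GI; apply: mem_nth.
Qed.

End Obstructions.

Section Execution.
Context (K : fieldType) (n : nat) (sigma : rel (word n)).
Context (hsigma : word_ordering sigma).
Notation W := (word n).
Notation A := (freealg K n).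
Notation F := (freebimod K n).
Context (g : seq A) (D : nat -> set F) (st : nat -> state K n) (sel : nat -> F).
Hypothesis hexec : execution sigma g D st sel.
Hypothesis hg : forall f, f \in g -> f != 0.
Notation H := [set f | exists T, f \in polys (st T)].
Notation I := (ideal_gen [set` g]).

Lemma execution_stop T : pending (st T) = set0 -> st T.+1 = st T.
Proof. by move=> h0; case: hexec => _ /(_ T); case: ifP => // /asboolP. Qed.

Lemma execution_round T : pending (st T) <> set0 ->
  pending (st T) (sel T) /\
  exists2 r, NR sigma (polys (st T)) (Spoly (polys (st T)) (sel T)) r &
    [/\ r = 0, polys (st T.+1) = polys (st T)
      & pending (st T.+1) = (pending (st T) `\ sel T) `\` D T] \/
    let s := size (polys (st T)) in let G := rcons (polys (st T)) r in
    [/\ r != 0, polys (st T.+1) = G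
      & pending (st T.+1) = ((pending (st T) `\ sel T) `|`
          [set o | exists2 i : nat, (i <= s)%N & NTObs sigma G i s o]) `\` D T].
Proof.
move=> h0; case: hexec => _ /(_ T); case: ifP => [/asboolP //|_].
case=> y [hsel [r hr]]; case: eqP => [r0|/eqP r0] -> -> /=; split=> //.
  by exists r => //; left.
by exists r => //; right.
Qed.

Lemma polysS T : polys (st T.+1) = polys (st T) \/
  exists2 r, r != 0 & polys (st T.+1) = rcons (polys (st T)) r.
Proof.
case: (pselect (pending (st T) = set0)) => [/execution_stop ->|]; first by left.
by case/execution_round => _ [r _ [[_ -> _]|[r0 -> _]]]; [left|right; exists r].
Qed.

Lemma polys_cat T T' : (T <= T')%N ->
  exists l, polys (st T') = polys (st T) ++ l.
Proof.
move/subnK <-; elim: (T' - T)%N => [|d [l IH]].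
  by exists [::]; rewrite cats0.
case: (polysS (d + T)) => [|[r _]]; rewrite addSn => ->; rewrite IH.
  by exists l.
by exists (rcons l r); rewrite rcons_cat.
Qed.

Lemma polys_neq0 T f : f \in polys (st T) -> f != 0.
Proof.
elim: T f => [|T IH] f; first by case: hexec => -> _; apply: hg.
case: (polysS T) => [|[r r0]] ->; first exact: IH.
by rewrite mem_rcons inE => /predU1P[->|/IH].
Qed.

Lemma polys_nth_neq0 T i :
  (i < size (polys (st T)))%N -> (polys (st T))`_i != 0.
Proof. by move=> hi; apply: (@polys_neq0 T); apply: mem_nth. Qed.

Lemma enumerated_neq0 h : H h -> h != 0.
Proof. by case=> T; apply: polys_neq0. Qed.

Lemma polys_ideal T : [set` polys (st T)] `<=` I.
Proof.
have hI : twosided_ideal I by apply: ideal_gen_twosided.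
elim: T => [|T IH]; first by case: hexec => -> _; apply: ideal_gen_sub.
case: (pselect (pending (st T) = set0)) => [/execution_stop -> //|].
case/execution_round => _ [r hr [[_ -> _] //|[r0 -> _]]] f /=.
rewrite mem_rcons inE => /predU1P[->|]; last exact: IH.
by apply: (division_ideal hI IH hr); rewrite add0r; apply: Spoly_ideal.
Qed.

Lemma pending_finite T : finite_set (pending (st T)).
Proof.
elim: T => [|T IH]; first by case: hexec => -> _; apply: finite_NTObs_upto.
case: (pselect (pending (st T) = set0)) => [/execution_stop -> //|].
case/execution_round => _ [r hr [[_ _ ->]|[r0 _ ->]]].
  by do 2!apply: finite_setD.
apply: finite_setD; rewrite finite_setU; split; first exact: finite_setD.
set s := size _; set G := rcons _ _.
apply: sub_finite_set (finite_NTObs_upto sigma G s.+1) => o [i his ho].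
by exists i, s; rewrite his ltnSn.
Qed.

Lemma NTObs_pending T i j o : (i <= j < size (polys (st T)))%N ->
  NTObs sigma (polys (st T)) i j o -> (exists T', D T' o) \/
  exists T', (j < size (polys (st T')))%N /\ pending (st T') o.
Proof.
elim: T => [|T IH] /andP[hij hj].
  move=> ho; right; exists 0%N; split => //; move: hj ho.
  by case: hexec => -> _ /= hj ho; exists i, j; rewrite hij hj.
case: (pselect (pending (st T) = set0)) => [h0|].
  by rewrite (execution_stop h0) in hj *; apply: IH; rewrite hij.
case/execution_round => _ [r hr [[_ e _]|[r0 e ep]]].
  by rewrite e in hj *; apply: IH; rewrite hij.
move: (hj); rewrite e size_rcons ltnS leq_eqVlt.
move=> /predU1P[ej|hj'] ho; last first.
  apply: IH; first by rewrite hij.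
  by move: ho; rewrite -cats1; apply: NTObs_cat => //; apply: leq_ltn_trans hj'.
case: (pselect (D T o)) => [hD|nD]; first by left; exists T.
right; exists T.+1; split=> //; rewrite ep; split=> //; right.
by exists i; rewrite -ej.
Qed.

Lemma selected_rep T M : pending (st T) (sel T) ->
  (forall u, u \in msupp (Spoly (polys (st T)) (sel T)) -> wlt sigma u M) ->
  rep sigma H (wlt sigma ^~ M) (Spoly (polys (st T)) (sel T)).
Proof.
move=> hp; have /execution_round[_ [r hr hr']] : pending (st T) <> set0.
  by move=> h0; rewrite h0 in hp.
move=> hM; have GH : [set` polys (st T)] `<=` H by move=> f hf; exists T.
have [h1 h2] := division_rep hsigma GH hM hr.
rewrite addr0 in h1; rewrite -[Spoly _ _](subrK r).
have hrep : rep sigma H (wlt sigma ^~ M) r.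
  case: hr' => [[-> _ _]|[r0 e _]]; first exact: span0.
  rewrite -[r]shift1; apply: rep_gen.
    by exists T.+1; rewrite e mem_rcons mem_head.
  rewrite mul1m mulm1; apply: h2; last exact: Lw_mem.
  by move=> u; rewrite msupp0.
exact: spanD h1 hrep.
Qed.

Hypothesis hfair : fair D st sel.

Lemma nontrivial_rep T G i a a' j b b' : G = polys (st T) -> (i <= j)%N ->
  nontrivial sigma G i a a' j b b' ->
  (forall T', ~ D T' (obs sigma G i a a' j b b')) ->
  rep sigma H (wlt sigma ^~ (a * Lw sigma G`_i * a')%M)
    (spair sigma G`_i a a' G`_j b b').
Proof.
move=> eG hij nt nD; have [[hi hj e nz] _ _] := nt.
have [o eo] : exists o, o = obs sigma G i a a' j b b' by eexists.
rewrite -eo in nD.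
have ho : NTObs sigma (polys (st T)) i j o.
  by rewrite -eG; exists a, a', b, b'; split; [exact: nt|exact: eo].
have hijT : (i <= j < size (polys (st T)))%N by rewrite hij -eG.
have [[T' hD]|[T1 [hj1 hp1]]] := NTObs_pending hijT ho; first by case: (nD T').
have [T2 h12 [[hp2 hsel]|hD]] := hfair hp1; last by case: (nD T2).
have hj2 : (j < size (polys (st T2)))%N.
  by have [l ->] := polys_cat h12; rewrite size_cat ltn_addr.
have hi2 : (i < size (polys (st T2)))%N by apply: leq_ltn_trans hj2.
have nthE k : (k < size G)%N -> (k < size (polys (st T2)))%N ->
    G`_k = (polys (st T2))`_k.
  rewrite eG => h1 h2.
  have [/polys_cat[l ->]|/polys_cat[l ->]] := orP (leq_total T T2).
    by rewrite nth_cat h1.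
  by rewrite nth_cat h2.
have ei := nthE i hi hi2; have ej := nthE j hj hj2.
have eo2 : o = obs sigma (polys (st T2)) i a a' j b b'.
  by apply: (etrans eo); apply: obs_nth.
have hp : pending (st T2) (sel T2) by rewrite hsel.
have eS : Spoly (polys (st T2)) (sel T2) = spair sigma G`_i a a' G`_j b b'.
  by rewrite hsel eo2 Spoly_obs ei ej.
have := selected_rep hp; rewrite eS => hrep; apply: hrep => u.
by apply: (spair_msupp hsigma _ _ e); rewrite ?ei ?ej; apply: polys_nth_neq0.
Qed.

Lemma enumerates_groebner_rep :
  ((forall h, H h -> Lw sigma h <> 1%M) ->
   forall T G i a a' j b b', G = polys (st T) -> (i <= j)%N ->
    nontrivial sigma G i a a' j b b' ->
    rep sigma H (wlt sigma ^~ (a * Lw sigma G`_i * a')%M)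
      (spair sigma G`_i a a' G`_j b b')) ->
  enumerates_groebner sigma I st.
Proof.
move=> hnt; apply/groebner_basisP => [f [T]|f hf nzf]; first exact: polys_ideal.
case: (pselect (exists2 h, H h & Lw sigma h = 1%M)) => [[h hh h1]|no1].
  exists h, (Lw sigma f), 1%M; rewrite h1 !mulm1.
  by split => //; apply: enumerated_neq0.
have n1 h : H h -> Lw sigma h <> 1%M by move=> hh h1; apply: no1; exists h.
have {}hnt := hnt n1.
have size_gt0 h : H h -> (0 < size (Lw sigma h))%N.
  by move=> /n1 h1; case: posnP => // /word_size_eq0.
have [M hM] : exists M, rep sigma H (sigma ^~ M) f.
  apply: rep_ideal_gen => //; move: f hf {nzf}; apply: ideal_gen_min.
    exact: ideal_gen_twosided.
  by move=> f hf; apply: ideal_gen_sub; exists 0%N; case: hexec => -> _.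
have ex2 p q : H p -> H q -> exists T G i j, [/\ G = polys (st T),
    (i < size G)%N, (j < size G)%N, p = G`_i /\ q = G`_j & (p = q -> i = j)].
  move=> [T1 h1] [T2 h2]; pose T := maxn T1 T2.
  have hp : p \in polys (st T).
    by have [l ->] := polys_cat (leq_maxl T1 T2); rewrite mem_cat h1.
  have hq : q \in polys (st T).
    by have [l ->] := polys_cat (leq_maxr T1 T2); rewrite mem_cat h2.
  exists T, (polys (st T)), (index p (polys (st T))), (index q (polys (st T))).
  by rewrite !index_mem !nth_index //; split => // ->.
apply: (rep_Lw_divisible hsigma enumerated_neq0 _ hM nzf).
apply: (rep_spair hsigma enumerated_neq0 n1) => p q w w' hp hq.
  have [T [G [i [j [eG hi hj [ep eq] _]]]]] := ex2 p q hp hq.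
  have nzp := enumerated_neq0 hp; have nzq := enumerated_neq0 hq.
  have lq := size_gt0 q hq; move: nzp nzq lq.
  rewrite {}ep {}eq {hp hq} => nzp nzq lq npq e.
  have nij : i != j by apply/eqP => eij; apply: npq; rewrite eij.
  have lp : (size w < size (Lw sigma G`_i))%N.
    by rewrite e !word_size_mul; lia.
  have e1 : (1 * Lw sigma G`_i * 1)%M = (w * Lw sigma G`_j * w')%M.
    by rewrite mul1m mulm1.
  have := nij; rewrite neq_ltn => /orP[ij|ji].
    have h := hnt T G i 1%M 1%M j w w' eG (ltnW ij).
    rewrite mul1m mulm1 in h; apply: h; apply: nontrivialI => //.
    - by rewrite !xpair_eqE (negPf nij).
    - by exists (size w); rewrite word_size1; lia.
    by rewrite (negPf nij); apply: Or44.
  have h := hnt T G j w w' i 1%M 1%M eG (ltnW ji).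
  have -> : wlt sigma ^~ (Lw sigma G`_i) =
      wlt sigma ^~ (1 * Lw sigma G`_i * 1)%M by rewrite mul1m mulm1.
  apply: rep_spairC; first exact: esym e1.
  apply: h; apply: nontrivialI => //.
  - by rewrite !xpair_eqE eq_sym (negPf nij).
  - by exists (size w); rewrite word_size1; lia.
  by rewrite eq_sym (negPf nij); apply: Or43.
have [T [G [i [j [eG hi hj [ep eq] eij]]]]] := ex2 p q hp hq.
have nzp := enumerated_neq0 hp; have nzq := enumerated_neq0 hq.
have lq := size_gt0 q hq; move: nzp nzq lq eij.
rewrite {}ep {}eq {hp hq} => nzp nzq lq eij npq e lw.
have e1 : (1 * Lw sigma G`_i * w')%M = (w * Lw sigma G`_j * 1)%M.
  by rewrite mul1m mulm1.
case: (ltngtP i j) => [ij|ji|ij].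
- have h := hnt T G i 1%M w' j w 1%M eG (ltnW ij).
  rewrite mul1m in h; apply: h; apply: nontrivialI => //.
  + by rewrite !xpair_eqE (ltn_eqF ij).
  + by exists (size w); rewrite word_size1; lia.
  by rewrite (ltn_eqF ij); apply: Or42.
- have h := hnt T G j w 1%M i 1%M w' eG (ltnW ji).
  have -> : wlt sigma ^~ (Lw sigma G`_i * w')%M =
      wlt sigma ^~ (1 * Lw sigma G`_i * w')%M by rewrite mul1m.
  apply: rep_spairC; first exact: esym e1.
  apply: h; apply: nontrivialI => //.
  + by rewrite !xpair_eqE (ltn_eqF ji).
  + by exists (size w); rewrite word_size1; lia.
  by rewrite (ltn_eqF ji); apply: Or41.
subst j; have w1 : w <> 1%M by apply: npq.
have w1' : w' <> 1%M.
  move=> h; have := congr1 (fun m : W => size m) e1.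
  rewrite h !word_size_mul !word_size1 => es.
  by apply: w1; apply: word_size_eq0; lia.
have h := hnt T G i 1%M w' i w 1%M eG (leqnn i).
rewrite mul1m in h; apply: h; apply: nontrivialI => //.
- by apply/eqP => -[/esym].
- by exists (size w); rewrite word_size1; lia.
by rewrite eqxx.
Qed.

Lemma groebner_stage : enumerates_groebner sigma I st ->
  has_finite_groebner sigma I ->
  exists T, groebner_basis sigma I [set` polys (st T)].
Proof.
move=> enumG [B /finite_seqP[l el] gbB].
have HI : H `<=` I by move=> h [T]; apply: polys_ideal.
have /(groebner_basisP sigma HI) hH := enumG.
have BI : B `<=` I by case: gbB.
have /(groebner_basisP sigma BI) hB := gbB.
have divS T T' u : (T <= T')%N -> divisible sigma [set` polys (st T)] u ->
    divisible sigma [set` polys (st T')] u.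
  move=> /polys_cat[k ->] [h [w [w' [hh nz e]]]]; exists h, w, w'; split => //.
  by rewrite /= mem_cat; apply/orP; left.
have [T hT] : exists T, forall b, b \in l -> b != 0 ->
    divisible sigma [set` polys (st T)] (Lw sigma b).
  have : forall b, b \in l -> I b by move=> b hb; apply: BI; rewrite el.
  elim: (l) => [|b k IH] hk; first by exists 0%N.
  have [|T1 hT1] := IH; first by move=> c hc; apply: hk; rewrite inE hc orbT.
  have [b0|nzb] := eqVneq b 0.
    exists T1 => c; rewrite inE => /predU1P[->|]; last exact: hT1.
    by rewrite b0 eqxx.
  have [h [w [w' [[T2 hh] nzh ew]]]] := hH b (hk b (mem_head _ _)) nzb.
  exists (maxn T1 T2) => c; rewrite inE => /predU1P[-> _|hc nzc].
    by apply: (divS T2); [exact: leq_maxr|exists h, w, w'].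
  by apply: (divS T1); [exact: leq_maxl|exact: hT1].
exists T; apply/groebner_basisP => [|f hf nzf]; first exact: polys_ideal.
have [b [w [w' [hb nzb ->]]]] := hB f hf nzf.
by apply: divisible_shift; apply: hT => //; rewrite el in hb.
Qed.

Lemma groebner_round T : groebner_basis sigma I [set` polys (st T)] ->
  pending (st T) <> set0 ->
  [/\ pending (st T) (sel T), polys (st T.+1) = polys (st T)
    & pending (st T.+1) `<=` pending (st T) `\ sel T].
Proof.
move=> gb /execution_round [hsel [r hr hr']].
case: hr' => [[_ eG ->]|[r0 _ _]]; first by split => //; apply: subDsetl.
have hI : twosided_ideal I by apply: ideal_gen_twosided.
have rI : I r.
  apply: (division_ideal hI (@polys_ideal T) hr); rewrite add0r.
  by apply: Spoly_ideal => //; apply: polys_ideal.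
have /(groebner_basisP sigma (@polys_ideal T)) /(_ r rI r0) hdiv := gb.
case: (division_irreducible hr _ (Lw_mem sigma r0) hdiv) => u.
by rewrite msupp0.
Qed.

Lemma groebner_stops T : groebner_basis sigma I [set` polys (st T)] ->
  stops_with_groebner sigma I st.
Proof.
move=> gb; have /finite_seqP[l el] := pending_finite T.
have hp : pending (st T) `<=` [set` l] by rewrite el.
have [m] := ubnP (size l); elim: m l T gb hp {el} => // m IH k T gb hp hk.
case: (pselect (pending (st T) = set0)) => [h0|]; first by exists T.
case/(groebner_round gb) => hs eT hp'.
have hsk : sel T \in k by apply: hp.
apply: (IH (rem (sel T) k) T.+1); first by rewrite eT.
  move=> o /hp' [/hp ho ne]; rewrite /= in ho *.
  have : o \in sel T :: rem (sel T) k by rewrite -(perm_mem (perm_to_rem hsk)).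
  by rewrite inE => /predU1P[e|//]; case: ne.
by rewrite size_rem //; case: k hk {hp} hsk.
Qed.

End Execution.

Theorem proposition3p14 (K : fieldType) (n : nat) (sigma : rel (word n))
  (hsigma : word_ordering sigma)
  (g : seq (freealg K n))
  (hg_nonempty : (0 < size g)%N)
  (hg_nonzero : forall f, f \in g -> f != 0)
  (st : nat -> state K n) (sel : nat -> freebimod K n) (t : nat)
  (G : seq (freealg K n)) (s : nat)
  (hG : G = polys (st t.+1))
  (hs : s = size (polys (st t)))
  (* round t has just appended the new element G`_s *)
  (happended : size G = s.+1)
  (i j : nat) (hij : (i <= j < s)%N)
  (wi wi' wj wj' : word n)
  (hnontrivial : nontrivial sigma G i wi wi' j wj wj')
  (w w' : word n)
  (ha : (wj * Lw sigma G`_j * wj')%M = (w * Lw sigma G`_s * w')%M)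
  (hb : ~ overlap sigma G i wi wi' s w w' \/
        exists2 k : nat, (k <= s)%N &
          multiple_of_NTObs sigma G k s (obs sigma G i wi wi' s w w'))
  (hc : ~ overlap sigma G j wj wj' s w w' \/
        exists2 k : nat, (k <= s)%N &
          multiple_of_NTObs sigma G k s (obs sigma G j wj wj' s w w'))
  (hexec : execution sigma g (delete_at t (obs sigma G i wi wi' j wj wj')) st sel)
  (hfair : fair (delete_at t (obs sigma G i wi wi' j wj wj')) st sel) :
  enumerates_groebner sigma (ideal_gen [set` g]) st /\
  (has_finite_groebner sigma (ideal_gen [set` g]) ->
   stops_with_groebner sigma (ideal_gen [set` g]) st).
Proof.
suff enumG : enumerates_groebner sigma (ideal_gen [set` g]) st.
  split=> // finG; have [T gbT] := groebner_stage hexec enumG finG.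
  exact: (groebner_stops hexec gbT).
have [hi_s hj_s] : (i < s)%N /\ (j < s)%N.
  by case/andP: hij => ij js; split=> //; apply: leq_ltn_trans js.
have [o eo] : exists o, o = obs sigma G i wi wi' j wj wj' by eexists.
rewrite -eo in hexec hfair.
have [[_ _ e _] _ _] := hnontrivial.
pose H := [set f | exists T, f \in polys (st T)].
have HG k : (k <= s)%N -> H G`_k.
  by move=> ks; exists t.+1; rewrite -hG mem_nth // happended ltnS.
have nz k : (k <= s)%N -> G`_k != 0.
  by move/HG; apply: (enumerated_neq0 hexec hg_nonzero).
have only_o T o' : delete_at t o T o' -> o' = o.
  by rewrite /delete_at; case: ifP.
have new_rep k a a' b b' : (k <= s)%N -> nontrivial sigma G k a a' s b b' ->
    rep sigma H (wlt sigma ^~ (a * Lw sigma G`_k * a')%M)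
      (spair sigma G`_k a a' G`_s b b').
  move=> ks nt; apply: (nontrivial_rep hsigma hexec hg_nonzero hfair hG ks nt).
  move=> T /only_o e'; have [[_ _ _ nzo] _ _] := nt.
  have := msupp_obsr (nz s (leqnn s)) nzo.
  by rewrite e' eo => /msupp_obs[] [es _ _]; move: hi_s hj_s; rewrite es ltnn.
apply: (enumerates_groebner_rep hsigma hexec hg_nonzero) => n1.
have with_s k a a' : (k < s)%N ->
    (a * Lw sigma G`_k * a')%M = (w * Lw sigma G`_s * w')%M ->
    ~ overlap sigma G k a a' s w w' \/ (exists2 l : nat, (l <= s)%N &
      multiple_of_NTObs sigma G l s (obs sigma G k a a' s w w')) ->
    rep sigma H (wlt sigma ^~ (a * Lw sigma G`_k * a')%M)
      (spair sigma G`_k a a' G`_s w w').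
  move=> ks ek [nov|[l ls [c [c' [d [d' [u [u' [nt eobs]]]]]]]]].
    have ks' := ltnW ks.
    by apply: rep_no_overlap => //; [exact: HG|exact: HG|exact: nz|exact: nz
      |exact/n1/HG|exact/n1/HG].
  have nzo : obs sigma G k a a' s w w' != 0.
    by apply: obs_neq0; [exact/nz/ltnW|rewrite !xpair_eqE (ltn_eqF ks)].
  have [[_ _ el _] _ _] := nt.
  have el' : ((u * c) * Lw sigma G`_l * (c' * u'))%M =
      ((u * d) * Lw sigma G`_s * (d' * u'))%M.
    have := congr1 (fun v => (u * v * u')%M) el.
    by rewrite /= !mulmA.
  rewrite (obs_lcm nzo eobs ek el') -!Spoly_obs eobs Spoly_obs.
  exact/rep_spair_multiple/new_rep.
have o_rep : rep sigma H (wlt sigma ^~ (wi * Lw sigma G`_i * wi')%M)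
    (spair sigma G`_i wi wi' G`_j wj wj').
  have hi := with_s i wi wi' hi_s (etrans e ha) hb.
  have hj := with_s j wj wj' hj_s ha hc.
  rewrite -e in hj.
  have -> : spair sigma G`_i wi wi' G`_j wj wj' =
      spair sigma G`_i wi wi' G`_s w w' - spair sigma G`_j wj wj' G`_s w w'.
    by rewrite /spair opprB addrA subrK.
  exact: spanB hi hj.
move=> T G1 k a a' l b b' eG1 kl nt.
have [eo1|neo] := eqVneq (obs sigma G1 k a a' l b b') o; last first.
  apply: (nontrivial_rep hsigma hexec hg_nonzero hfair eG1 kl nt).
  by move=> T' /only_o /eqP; apply/negP.
have [[hk1 hl1 e1 nzo1] _ _] := nt.
have [P [[r hr] [r' hr']]] : exists P, (exists r, P = G1 ++ r) /\
    (exists r', P = G ++ r').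
  exists (polys (st (maxn T t.+1))); rewrite eG1 hG.
  by split; apply: (polys_cat hexec); [apply: leq_maxl|apply: leq_maxr].
have nthl q : (q < size G1)%N -> G1`_q = P`_q.
  by move=> hq; rewrite hr nth_cat hq.
have nthr q : (q < s)%N -> G`_q = P`_q.
  by move=> hq; rewrite hr' nth_cat happended ltnS ltnW.
have [ek el] := conj (nthl k hk1) (nthl l hl1).
have [ei ej] := conj (nthr i hi_s) (nthr j hj_s).
have eoP : obs sigma P k a a' l b b' = obs sigma P i wi wi' j wj wj'.
  apply: (etrans (obs_nth _ _ _ _ _ (esym ek) (esym el))); apply: (etrans eo1).
  exact: etrans eo (obs_nth _ _ _ _ _ ei ej).
have nzP : obs sigma P k a a' l b b' != 0.
  by rewrite -(obs_nth _ _ _ _ _ ek el).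
rewrite ek el in e1 *; rewrite ei ej in e o_rep.
by rewrite (obs_lcm nzP eoP e1 e) -Spoly_obs eoP Spoly_obs.
Qed.
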